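(* The only protoalgebraic extension of $\mathrm{BD}_\infty$ other than the trivial logic $\mathrm{TRIV}$ and the almost trivial logic $\mathrm{TRIV}_-$ is classical logic $\mathrm{CL}_1$.
   Context: Formulas are built from variables using $\wedge,\vee,\neg$. A structure is a pair $\langle\mathbf{A},F\rangle$, $F\subseteq A$; a rule $\Gamma\vdash\varphi$ is valid in it if every homomorphism $v$ from the formula algebra with $v[\Gamma]\subseteq F$ has $v(\varphi)\in F$. A logic is a substitution-invariant consequence relation; an extension of a logic is a logic containing its consequence relation. $\mathrm{BD}_\infty$ is the logic determined by all $\langle\mathbf{A},F\rangle$ with $\mathbf{A}$ a De~Morgan lattice (distributive lattice with $\neg$, $\neg\neg x=x$, De~Morgan laws) and $F$ an upset. $\mathrm{TRIV}$: $\Gamma\vdash\varphi$ always holds; $\mathrm{TRIV}_-$: $\Gamma\vdash\varphi$ holds iff $\Gamma\ne\emptyset$. $\mathrm{CL}_1$ is classical propositional logic, the logic of the two-element Boolean algebra with designated set $\{1\}$. A logic $\mathcal{L}$ is protoalgebraic if there is a set $\Delta(x,y)$ of formulas in two variables with $\emptyset\vdash_{\mathcal{L}}\delta(x,x)$ for each $\delta\in\Delta$ and $x,\Delta(x,y)\vdash_{\mathcal{L}}y$. *)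

(* Defs.v *)
From mathcomp Require Import all_boot all_order.
From mathcomp Require Import boolp classical_sets.

Set Implicit Arguments.
Unset Strict Implicit.
Unset Printing Implicit Defensive.

Local Open Scope classical_set_scope.

(* No constants: the signature is exactly {and, or, not}. *)
Inductive form : Type :=
| Var of nat
| And of form & form
| Or of form & form
| Not of form.

Record algebra := Algebra {
  carrier :> Type;
  meetA : carrier -> carrier -> carrier;
  joinA : carrier -> carrier -> carrier;
  negA : carrier -> carrier }.

Definition formula_algebra : algebra := @Algebra form And Or Not.

Definition homomorphism (A B : algebra) (h : A -> B) : Prop :=
  [/\ forall x y : A, h (meetA x y) = meetA (h x) (h y),
      forall x y : A, h (joinA x y) = joinA (h x) (h y)
    & forall x : A, h (negA x) = negA (h x)].

Definition valid (A : algebra) (F : set A) (Gamma : set form) (phi : form)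
    : Prop :=
  forall v : formula_algebra -> A,
    homomorphism v -> v @` Gamma `<=` F -> F (v phi).

Definition entailment := set form -> form -> Prop.

(* Consequence relations are not assumed finitary. *)
Definition consequence_relation (L : entailment) : Prop :=
  [/\ forall (Gamma : set form) (phi : form), Gamma phi -> L Gamma phi,
      forall (Gamma Delta : set form) (phi : form),
        Gamma `<=` Delta -> L Gamma phi -> L Delta phi
    & forall (Gamma Delta : set form) (phi : form),
        (forall psi, Delta psi -> L Gamma psi) -> L Delta phi -> L Gamma phi].

Definition substitution_invariant (L : entailment) : Prop :=
  forall s : formula_algebra -> formula_algebra, homomorphism s ->
  forall (Gamma : set form) (phi : form),
    L Gamma phi -> L (s @` Gamma) (s phi).

Definition logic (L : entailment) : Prop :=
  consequence_relation L /\ substitution_invariant L.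

Definition extension (L0 L : entailment) : Prop :=
  logic L /\ forall (Gamma : set form) (phi : form), L0 Gamma phi -> L Gamma phi.

(* De Morgan lattices need not be bounded. *)
Definition de_morgan (d : Order.disp_t) (T : distrLatticeType d)
    (neg : T -> T) : Prop :=
  [/\ forall x : T, neg (neg x) = x,
      forall x y : T, neg (Order.meet x y) = Order.join (neg x) (neg y)
    & forall x y : T, neg (Order.join x y) = Order.meet (neg x) (neg y)].

(* Upsets may be empty. *)
Definition upset (d : Order.disp_t) (T : distrLatticeType d) (F : set T)
    : Prop :=
  forall x y : T, (x <= y)%O -> F x -> F y.

Definition BD_infty : entailment := fun Gamma phi =>
  forall (d : Order.disp_t) (T : distrLatticeType d) (neg : T -> T),
    de_morgan neg ->
  forall F : set T, upset F ->
    @valid (@Algebra T Order.meet Order.join neg) F Gamma phi.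

Definition TRIV : entailment := fun _ _ => True.

Definition TRIV_minus : entailment := fun Gamma _ => Gamma !=set0.

Definition bool_algebra : algebra := @Algebra bool andb orb negb.

Definition CL1 : entailment := @valid bool_algebra [set true].

Fixpoint variables (phi : form) : seq nat :=
  match phi with
  | Var n => [:: n]
  | And a b | Or a b => variables a ++ variables b
  | Not a => variables a
  end.

Fixpoint subst (s : nat -> form) (phi : form) : form :=
  match phi with
  | Var n => s n
  | And a b => And (subst s a) (subst s b)
  | Or a b => Or (subst s a) (subst s b)
  | Not a => Not (subst s a)
  end.

(* x is [Var 0] and y is [Var 1], so [delta(x,x)] replaces both by [Var 0];
   the set Delta may be empty. *)
Definition protoalgebraic (L : entailment) : Prop :=
  exists Delta : set form,
    [/\ forall delta, Delta delta -> {subset variables delta <= [:: 0; 1]},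
        forall delta, Delta delta -> L set0 (subst (fun=> Var 0) delta)
      & L ([set Var 0] `|` Delta) (Var 1)].

Definition protoalgebraic_extension (L0 L : entailment) : Prop :=
  extension L0 L /\ protoalgebraic L.

(* Main.v *)
Require Import Defs.
From mathcomp Require Import all_boot all_order.
From mathcomp Require Import boolp classical_sets.

(** Write [x <-> y] for [(x /\ y) \/ (~ x /\ ~ y)].  Kalmár's lemma holds in
    De Morgan lattices: a formula true (false) under a Boolean valuation lies
    above (its negation lies above) the meet of the corresponding literals.
    Hence, in a nontrivial protoalgebraic extension, every [delta(x,y)] lies
    above [x <-> y], so that [x, x <-> y |- y], and [x \/ ~ x] is a theorem.
    For a theorem [T], excluded middle for [(T /\ c) \/ ~ T] lies below
    [T <-> T /\ (c \/ ~ c)], so theorems are closed under conjunction with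
    [c \/ ~ c]; again by Kalmár's lemma, all tautologies are theorems.
    Since [b <-> b /\ c] is a tautology when [b] classically entails [c],
    single-premise classical rules hold; since [b] classically entails
    [a <-> a /\ b], adjunction holds.  Compactness then gives all of classical
    logic, whose only proper extensions are trivial. *)

Set Implicit Arguments.
Unset Strict Implicit.
Unset Printing Implicit Defensive.

Import Order.TTheory.
Local Open Scope classical_set_scope.

(** * Boolean valuations and classical consequence *)

Fixpoint evalb (u : nat -> bool) (phi : form) : bool :=
  match phi with
  | Var n => u n
  | And a b => evalb u a && evalb u b
  | Or a b => evalb u a || evalb u b
  | Not a => ~~ evalb u a
  end.

Definition tautology (phi : form) : Prop := forall u, evalb u phi.

Definition lem (a : form) : form := Or a (Not a).

Definition iff_form (a b : form) : form := Or (And a b) (And (Not a) (Not b)).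

Lemma homomorphism_evalb (u : nat -> bool) :
  @homomorphism formula_algebra bool_algebra (evalb u).
Proof. by []. Qed.

Lemma homomorphism_boolE (v : formula_algebra -> bool_algebra) :
  homomorphism v -> forall phi, v phi = evalb (fun n => v (Var n)) phi.
Proof.
move=> [vA vO vN]; elim=> [n|a IHa b IHb|a IHa b IHb|a IHa] //=.
- by rewrite -IHa -IHb -[RHS]vA.
- by rewrite -IHa -IHb -[RHS]vO.
- by rewrite -IHa -[RHS]vN.
Qed.

Lemma CL1P (Gamma : set form) (phi : form) :
  CL1 Gamma phi <->
  forall u, (forall psi, Gamma psi -> evalb u psi) -> evalb u phi.
Proof.
split=> [H u Hu|H v hv Hv].
  by apply: (H _ (homomorphism_evalb u)) => _ [psi Gpsi <-]; apply: Hu.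
rewrite (homomorphism_boolE hv); apply: H => psi Gpsi.
by rewrite -(homomorphism_boolE hv); apply: Hv; exists psi.
Qed.

Lemma homomorphism_subst (s : nat -> form) :
  @homomorphism formula_algebra formula_algebra (subst s).
Proof. by []. Qed.

Lemma evalb_subst (s : nat -> form) (u : nat -> bool) (phi : form) :
  evalb u (subst s phi) = evalb (fun n => evalb u (s n)) phi.
Proof. by elim: phi => //= [a -> b ->|a -> b ->|a ->]. Qed.

Lemma eq_evalb (u w : nat -> bool) (phi : form) :
  {in variables phi, u =1 w} -> evalb u phi = evalb w phi.
Proof.
elim: phi => /= [n|a IHa b IHb|a IHa b IHb|a IHa] uw.
- by apply: uw; rewrite inE.
- by rewrite IHa ?IHb // => p ps; apply: uw; rewrite mem_cat ps ?orbT.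
- by rewrite IHa ?IHb // => p ps; apply: uw; rewrite mem_cat ps ?orbT.
- by rewrite IHa.
Qed.

(** * Kalmár's lemma in De Morgan lattices *)

Section DeMorganLattice.

Variables (d : Order.disp_t) (T : distrLatticeType d) (neg : T -> T).
Hypothesis dm : de_morgan neg.
Variable v : formula_algebra -> @Algebra T Order.meet Order.join neg.
Hypothesis hv : homomorphism v.

Let m (phi : form) : T := v phi.

Lemma dm_And (a b : form) : m (And a b) = (m a `&` m b)%O.
Proof. by case: hv => H _ _; exact: H. Qed.

Lemma dm_Or (a b : form) : m (Or a b) = (m a `|` m b)%O.
Proof. by case: hv => _ H _; exact: H. Qed.

Lemma dm_Not (a : form) : m (Not a) = neg (m a).
Proof. by case: hv => _ _ H; exact: H. Qed.

Lemma dm_NotNot (a : form) : m (Not (Not a)) = m a.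
Proof. by rewrite !dm_Not; case: dm. Qed.

Lemma dm_NotAnd (a b : form) : m (Not (And a b)) = (m (Not a) `|` m (Not b))%O.
Proof. by rewrite !dm_Not dm_And; case: dm. Qed.

Lemma dm_NotOr (a b : form) : m (Not (Or a b)) = (m (Not a) `&` m (Not b))%O.
Proof. by rewrite !dm_Not dm_Or; case: dm. Qed.

(** By De Morgan, [a = a /\ ~ b] gives [~ a = ~ a \/ b]. *)
Lemma dm_le_Not (a b : form) : (m a <= m (Not b))%O -> (m b <= m (Not a))%O.
Proof.
move=> /meet_idPl ab.
have := dm_NotAnd a (Not b); rewrite dm_Not dm_And ab -dm_Not dm_NotNot => ->.
exact: leUr.
Qed.

Let mem_catl (p : nat) (s t : seq nat) : p \in s -> p \in s ++ t.
Proof. by rewrite mem_cat => ->. Qed.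

Let mem_catr (p : nat) (s t : seq nat) : p \in t -> p \in s ++ t.
Proof. by rewrite mem_cat orbC => ->. Qed.

(** An arbitrary lower bound [x] replaces the meet of the literals, so no finite meet has to be
    formed. The De Morgan laws carry the induction. *)
Lemma dm_kalmar (w : nat -> bool) (x : T) (phi : form) :
  (forall p, p \in variables phi ->
     (x <= m (if w p then Var p else Not (Var p)))%O) ->
  (x <= m (if evalb w phi then phi else Not phi))%O.
Proof.
elim: phi => /= [n|a IHa b IHb|a IHa b IHb|a IHa] H.
- by apply: H; rewrite inE.
- have Ha p ps := H p (@mem_catl p _ (variables b) ps).
  have Hb p ps := H p (@mem_catr p (variables a) _ ps).
  case: (evalb w a) (evalb w b) (IHa Ha) (IHb Hb) => [] [] /= xa xb.
  + by rewrite dm_And lexI xa.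
  + by rewrite dm_NotAnd lexU2 // xb orbT.
  + by rewrite dm_NotAnd lexU2 // xa.
  + by rewrite dm_NotAnd lexU2 // xa.
- have Ha p ps := H p (@mem_catl p _ (variables b) ps).
  have Hb p ps := H p (@mem_catr p (variables a) _ ps).
  case: (evalb w a) (evalb w b) (IHa Ha) (IHb Hb) => [] [] /= xa xb.
  + by rewrite dm_Or lexU2 // xa.
  + by rewrite dm_Or lexU2 // xa.
  + by rewrite dm_Or lexU2 // xb orbT.
  + by rewrite dm_NotOr lexI xa.
- by move: (IHa H); case: (evalb w a) => //=; rewrite dm_NotNot.
Qed.

(** The list [s] holds the variables still undecided, and [w] decides the others; once [s] is empty,
    Kalmár's lemma applies. *)
Lemma dm_tautology_rec (phi : form) (s : seq nat) (w : nat -> bool) (x : T) :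
  tautology phi ->
  (forall p, p \in s -> (x <= m (lem (Var p)))%O) ->
  (forall p, p \in variables phi -> p \notin s ->
     (x <= m (if w p then Var p else Not (Var p)))%O) ->
  (x <= m phi)%O.
Proof.
move=> taut; elim: s w x => [|p s IHs] w x xs xw.
  by have := @dm_kalmar w x phi; rewrite taut; apply=> p /xw; apply.
have xp : (x <= m (lem (Var p)))%O by apply: xs; rewrite inE eqxx.
(* Since [x] lies below [p \/ ~ p], distributivity splits it into its meets with [p] and with
   [~ p]. *)
rewrite -(meet_idPl xp) dm_Or meetUr leUx.
suff split_p b : (x `&` m (if b then Var p else Not (Var p)) <= m phi)%O.
  by rewrite (split_p true) (split_p false).
apply: (IHs (fun q => if q == p then b else w q)) => [q qs|q qphi qs].
  by rewrite leIx2 // xs // inE qs orbT.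
case: eqP => [->|/eqP qp]; first by rewrite leIr.
by rewrite leIx2 // xw // inE negb_or qp.
Qed.

Lemma dm_tautology (phi : form) (x : T) :
  tautology phi ->
  (forall p, p \in variables phi -> (x <= m (lem (Var p)))%O) ->
  (x <= m phi)%O.
Proof.
by move=> taut xs; apply: (dm_tautology_rec (w := xpredT) taut xs) => p ->.
Qed.

End DeMorganLattice.

(** * Inequalities holding in every De Morgan lattice *)

Definition dm_le (a b : form) : Prop :=
  forall (d : Order.disp_t) (T : distrLatticeType d) (neg : T -> T),
    de_morgan neg ->
  forall v : formula_algebra -> @Algebra T Order.meet Order.join neg,
    homomorphism v -> ((v a : T) <= v b)%O.

Lemma BD_infty_dm_le (a b : form) : dm_le a b -> BD_infty [set a] b.
Proof.
move=> ab d T neg dm F upF v hv Fa.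
by apply: upF (ab _ _ _ dm _ hv) _; apply: Fa; exists a.
Qed.

(** The left side expands to the join of [t /\ c], [~ t], [~ t /\ t] and [~ c /\ t]. The first and
    last lie below the positive half of the biconditional, the other two below the negative half. *)
Lemma dm_le_lem_iff (t c : form) :
  dm_le (lem (Or (And t c) (Not t))) (iff_form t (And t (lem c))).
Proof.
move=> d T neg dm v hv.
rewrite !(dm_Or hv, dm_NotOr dm hv, dm_And hv, dm_NotAnd dm hv, dm_NotNot dm hv).
rewrite !meetUl !leUx -!andbA; apply/and4P; split.
- by apply/lexUl; rewrite !lexI !leIl lexU2 // leIr.
- by apply/lexUr; rewrite lexI lexx leUl.
- by apply/lexUr; rewrite lexI leIl lexU2 // leIl.
- by apply/lexUl; rewrite !lexI !leIr lexU2 // leIl orbT.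
Qed.

Lemma variables_subst_const (n : nat) (phi : form) :
  {subset variables (subst (fun=> Var n) phi) <= [:: n]}.
Proof.
by elim: phi => //= [k p|a IHa b IHb p|a IHa b IHb p] //;
  rewrite mem_cat => /orP[/IHa|/IHb].
Qed.

(** Kalmár's lemma at the all-true valuation puts [Var 0] below the negation of the substituted
    formula; contraposition finishes. *)
Lemma dm_le_subst_Not (phi : form) : evalb xpredT phi = false ->
  dm_le (subst (fun=> Var 0) phi) (Not (Var 0)).
Proof.
move=> phi0 d T neg dm v hv; apply: (dm_le_Not dm hv).
have := @dm_kalmar _ _ _ dm _ hv xpredT (v (Var 0)) (subst (fun=> Var 0) phi).
rewrite evalb_subst phi0; apply=> p /variables_subst_const.
by rewrite inE => /eqP ->.
Qed.

Lemma dm_le_subst_Var (phi : form) : evalb xpred0 phi = false ->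
  dm_le (subst (fun=> Var 0) phi) (Var 0).
Proof.
move=> phi0 d T neg dm v hv; rewrite -[leRHS](dm_NotNot dm hv).
apply: (dm_le_Not dm hv).
have := @dm_kalmar _ _ _ dm _ hv xpred0 (v (Not (Var 0)))
  (subst (fun=> Var 0) phi).
rewrite evalb_subst phi0; apply=> p /variables_subst_const.
by rewrite inE => /eqP ->.
Qed.

(** Kalmár's lemma at the all-true valuation handles [x /\ y], at the all-false one [~ x /\ ~ y]. *)
Lemma dm_le_iff_binary (phi : form) :
  {subset variables phi <= [:: 0; 1]} ->
  evalb xpredT phi -> evalb xpred0 phi ->
  dm_le (iff_form (Var 0) (Var 1)) phi.
Proof.
move=> phi01 phiT phiF d T neg dm v hv.
rewrite (dm_Or hv) leUx !(dm_And hv); apply/andP; split.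
  have := @dm_kalmar _ _ _ dm _ hv xpredT (v (Var 0) `&` v (Var 1))%O phi.
  rewrite phiT; apply=> p /phi01; rewrite !inE => /orP[] /eqP ->;
    by rewrite ?leIl ?leIr.
have := @dm_kalmar _ _ _ dm _ hv xpred0
  (v (Not (Var 0)) `&` v (Not (Var 1)))%O phi.
rewrite phiF; apply=> p /phi01; rewrite !inE => /orP[] /eqP ->;
  by rewrite ?leIl ?leIr.
Qed.

(** A formula in the single variable [x] and its negation both lie above [x /\ ~ x]; negating the
    second bound gives the claim. *)
Lemma dm_le_subst_lem (phi : form) :
  dm_le (subst (fun=> Var 0) phi) (lem (Var 0)).
Proof.
move=> d T neg dm v hv; set x : T := (v (Not (Var 0)) `&` v (Var 0))%O.
have low : (x <= v (subst (fun=> Var 0) phi))%O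
        && (x <= v (Not (subst (fun=> Var 0) phi)))%O.
  elim: phi => /= [n|a /andP[a1 a2] b /andP[b1 b2]|a /andP[a1 a2] b /andP[b1 b2]|
    a /andP[a1 a2]].
  - by rewrite leIr leIl.
  - by rewrite (dm_And hv) (dm_NotAnd dm hv) lexI a1 b1 lexU2 ?a2.
  - by rewrite (dm_Or hv) (dm_NotOr dm hv) lexI a2 b2 lexU2 ?a1.
  - by rewrite (dm_NotNot dm hv) a1 a2.
have := @dm_le_Not _ _ _ dm _ hv (Not (lem (Var 0))) (subst (fun=> Var 0) phi).
rewrite (dm_NotNot dm hv) (dm_NotOr dm hv) (dm_NotNot dm hv); apply.
by case/andP: low.
Qed.

(** * Extensions of [BD_infty] and their trivial cases *)

Section Extension.

Variable L : entailment.
Hypothesis extL : extension BD_infty L.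

Lemma ext_id (Gamma : set form) (phi : form) : Gamma phi -> L Gamma phi.
Proof. by case: extL => [[[H _ _] _] _]; exact: H. Qed.

Lemma ext_weaken (Gamma Delta : set form) (phi : form) :
  Gamma `<=` Delta -> L Gamma phi -> L Delta phi.
Proof. by case: extL => [[[_ H _] _] _]; exact: H. Qed.

Lemma ext_cut (Gamma Delta : set form) (phi : form) :
  (forall psi, Delta psi -> L Gamma psi) -> L Delta phi -> L Gamma phi.
Proof. by case: extL => [[[_ _ H] _] _]; exact: H. Qed.

Lemma ext_theorem (Gamma : set form) (phi : form) : L set0 phi -> L Gamma phi.
Proof. exact: ext_weaken (@sub0set _ _). Qed.

Lemma ext_subst (s : nat -> form) (Gamma : set form) (phi : form) :
  L Gamma phi -> L (subst s @` Gamma) (subst s phi).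
Proof. by case: extL => [[_ H] _]; apply: H; exact: homomorphism_subst. Qed.

Lemma ext_subst_theorem (s : nat -> form) (phi : form) :
  L set0 phi -> L set0 (subst s phi).
Proof. by move=> /(ext_subst s); rewrite image_set0. Qed.

Lemma ext_dm_le (Gamma : set form) (a b : form) :
  dm_le a b -> L Gamma a -> L Gamma b.
Proof.
move=> ab La; apply: (@ext_cut _ [set a]) => [_ ->//|].
by case: extL => _; apply; exact: BD_infty_dm_le.
Qed.

Lemma ext_TRIV : L set0 (Var 0) -> L = TRIV.
Proof.
move=> L0; apply/funext => Gamma; apply/funext => phi; apply/propext; split=> // _.
exact/ext_theorem/(ext_subst_theorem (fun=> phi) L0).
Qed.

Lemma ext_TRIV_Not : L set0 (Not (Var 0)) -> L = TRIV.
Proof.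
move=> /(ext_subst_theorem (fun=> Not (Var 0))) L0; apply/ext_TRIV.
by apply: ext_dm_le L0 => d T neg dm v hv; rewrite /= (dm_NotNot dm hv).
Qed.

(** Any premise yields everything, so a single theorem would already force [TRIV]. *)
Lemma ext_TRIV_minus : L [set Var 0] (Var 1) -> L <> TRIV -> L = TRIV_minus.
Proof.
move=> L01 nT.
have LP psi phi : L [set psi] phi.
  have := ext_subst (fun n => if n == 0 then psi else phi) L01.
  by rewrite image_set1.
apply/funext => Gamma; apply/funext => phi; apply/propext; split=> [Lphi|].
  apply/set0P/negP => /eqP G0; apply: nT; apply: ext_TRIV.
  by apply: ext_cut (LP phi _) => _ ->; rewrite -G0.
by case=> psi Gpsi; apply: ext_cut (LP psi _) => _ ->; exact: ext_id.
Qed.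

(** * Classical logic from excluded middle and detachment *)

Section Classical.

Hypothesis ext_lem : forall phi, L set0 (lem phi).
Hypothesis ext_iff : L [set Var 0; iff_form (Var 0) (Var 1)] (Var 1).

Lemma ext_detach (Gamma : set form) (a b : form) :
  L Gamma a -> L Gamma (iff_form a b) -> L Gamma b.
Proof.
move=> La Lab.
have := ext_subst (fun n => if n == 0 then a else b) ext_iff.
by apply: ext_cut => _ [_ [->|->] <-].
Qed.

Lemma ext_theorem_lem (t c : form) : L set0 t -> L set0 (And t (lem c)).
Proof.
move=> Lt; apply: (ext_detach Lt).
exact: ext_dm_le (@dm_le_lem_iff t c) (ext_lem _).
Qed.

Lemma ext_tautology (phi : form) : tautology phi -> L set0 phi.
Proof.
move=> taut.
(* The conjunction starts from [lem (Var 0)] because the language has no truth constant. *)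
pose t := foldr (fun p a => And a (lem (Var p))) (lem (Var 0)) (variables phi).
have Lt : L set0 t.
  rewrite /t; elim: (variables phi) => [|p s IHs]; first exact: ext_lem.
  exact: ext_theorem_lem.
apply: ext_dm_le Lt => d T neg dm v hv; apply: (dm_tautology dm hv taut).
rewrite /t; elim: (variables phi) => //= p s IHs q.
rewrite (dm_And hv) inE => /orP[/eqP ->|/IHs]; first by rewrite leIr.
by move=> le_q; rewrite leIx2 // le_q.
Qed.

Lemma ext_classical1 (Gamma : set form) (a b : form) :
  (forall u, evalb u a -> evalb u b) -> L Gamma a -> L Gamma b.
Proof.
move=> ab La; apply: (@ext_dm_le _ (And a b)).
  by move=> d T neg dm v hv; rewrite (dm_And hv) leIr.
apply/(ext_detach La)/ext_theorem/ext_tautology => u /=.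
by have := ab u; case: (evalb u a) => // /(_ isT) ->.
Qed.

Lemma ext_adjunction (Gamma : set form) (a b : form) :
  L Gamma a -> L Gamma b -> L Gamma (And a b).
Proof.
move=> La Lb; apply: (ext_detach La); apply: ext_classical1 Lb => u /= ->.
by case: (evalb u a).
Qed.

(* Compactness: a Boolean valuation refuting [Gamma |- phi] is built one
   variable at a time, keeping each [L]-consequence of [Gamma] true together
   with [~ phi] in some extension of the part already built. *)
Lemma ext_CL1 (Gamma : set form) (phi : form) : CL1 Gamma phi -> L Gamma phi.
Proof.
move=> /CL1P CLphi; apply: contrapT => nL.
pose good (s : seq bool) := forall psi, L Gamma psi ->
  exists u, [/\ forall i, i < size s -> u i = nth false s i,
                evalb u psi & ~~ evalb u phi].
have good0 : good [::].
  move=> psi Lpsi; apply: contrapT => nu; apply: nL.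
  apply: ext_classical1 Lpsi => u upsi; apply: contrapT => /negP uphi.
  by apply: nu; exists u.
(* If both continuations fail, at [psi1] and [psi2], the valuation found for [And psi1 psi2]
   contradicts one failure through its value at [size s]. *)
have goodS s : good s -> good (rcons s true) \/ good (rcons s false).
  move=> gs; apply: contrapT => /not_orP[].
  move=> /existsNP[psi1 /not_implyP[L1 n1]].
  move=> /existsNP[psi2 /not_implyP[L2 n2]].
  have [u [us /= /andP[u1 u2] uphi]] := gs _ (ext_adjunction L1 L2).
  have ext i : i < size (rcons s (u (size s))) ->
      u i = nth false (rcons s (u (size s))) i.
    rewrite size_rcons ltnS leq_eqVlt nth_rcons => /orP[/eqP ->|is_].
      by rewrite ltnn eqxx.
    by rewrite is_ us.
  by case: (u (size s)) ext => ext; [apply: n1|apply: n2]; exists u.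
pose pre := fix pre n : seq bool :=
  if n is n'.+1 then rcons (pre n') `[< good (rcons (pre n') true) >] else [::].
have size_pre n : size (pre n) = n by elim: n => //= n IH; rewrite size_rcons IH.
have good_pre n : good (pre n).
  by elim: n => //= n /goodS; case: asboolP => // ng [].
pose w i := nth false (pre i.+1) i.
have pre_nth n i : i < n -> nth false (pre n) i = w i.
  elim: n => // n IHn; rewrite ltnS leq_eqVlt => /orP[/eqP ->//|lt_in].
  by rewrite /= nth_rcons size_pre lt_in IHn.
have agree psi : L Gamma psi -> evalb w psi && ~~ evalb w phi.
  move=> Lpsi; pose n := (\max_(p <- variables psi ++ variables phi) p).+1.
  have [u [uw upsi uphi]] := good_pre n _ Lpsi.
  have uwE : {in variables psi ++ variables phi, u =1 w}.
    move=> p ps; have pn : p < n by rewrite ltnS leq_bigmax_seq.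
    by rewrite uw ?size_pre // pre_nth.
  rewrite -(@eq_evalb u w psi) ?upsi; last first.
    by move=> p ps; apply: uwE; rewrite mem_cat ps.
  rewrite -(@eq_evalb u w phi) // => p ps.
  by apply: uwE; rewrite mem_cat ps orbT.
(* [Gamma] may be empty, so a theorem serves as the consequence that shows [phi] false at [w]. *)
have /andP[_ /negP] := agree _ (ext_theorem Gamma (ext_lem (Var 0))); apply.
by apply: CLphi => psi Gpsi; have /andP[] := agree _ (ext_id Gpsi).
Qed.

(* A refuting Boolean valuation is itself a substitution by tautologies and
   contradictions. *)
Lemma ext_maximal (Gamma : set form) (phi : form) :
  L <> TRIV -> L Gamma phi -> CL1 Gamma phi.
Proof.
move=> nT Lphi; apply/CL1P => w wG; apply: contrapT => /negP wphi; apply: nT.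
pose s n := if w n then lem (Var 0) else Not (lem (Var 0)).
have evs u psi : evalb u (subst s psi) = evalb w psi.
  rewrite evalb_subst; apply: eq_evalb => p _.
  by rewrite /s; case: (w p) => /=; case: (u 0).
apply: ext_TRIV; apply: (@ext_classical1 _ (subst s phi)).
  by move=> u; rewrite evs (negbTE wphi).
apply: ext_cut (ext_subst s Lphi) => _ [psi Gpsi <-].
by apply: ext_tautology => u; rewrite evs wG.
Qed.

End Classical.

(** * Classification of the protoalgebraic extensions *)

Lemma protoalgebraic_ext_CL1 :
  protoalgebraic L -> L <> TRIV -> L <> TRIV_minus -> L = CL1.
Proof.
move=> [Delta [Dvar Dthm Ddet]] nT nTm.
(* With [Delta] empty, detachment reads [x |- y]. *)
have [D0|/set0P[delta Ddelta]] := eqVneq Delta set0.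
  by case: nTm; apply: ext_TRIV_minus => //; rewrite D0 setU0 in Ddet.
(* A member false at the all-true valuation would make [~ x] a theorem; one false at the all-false
   valuation would make [x] a theorem. *)
have DT a : Delta a -> evalb xpredT a.
  move=> Da; apply: contrapT => /negP/negbTE/dm_le_subst_Not a0.
  by apply/nT/ext_TRIV_Not; apply: ext_dm_le a0 (Dthm _ Da).
have DF a : Delta a -> evalb xpred0 a.
  move=> Da; apply: contrapT => /negP/negbTE/dm_le_subst_Var a0.
  by apply/nT/ext_TRIV; apply: ext_dm_le a0 (Dthm _ Da).
have iffP : L [set Var 0; iff_form (Var 0) (Var 1)] (Var 1).
  apply: ext_cut Ddet => psi [->|Dpsi]; first by apply: ext_id; left.
  apply: (@ext_dm_le _ (iff_form (Var 0) (Var 1))); last by apply: ext_id; right.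
  exact: dm_le_iff_binary (Dvar _ Dpsi) (DT _ Dpsi) (DF _ Dpsi).
have lemP phi : L set0 (lem phi).
  suff /(ext_subst_theorem (fun=> phi)) : L set0 (lem (Var 0)) by [].
  exact: ext_dm_le (@dm_le_subst_lem delta) (Dthm _ Ddelta).
apply/funext => Gamma; apply/funext => phi; apply/propext; split.
  exact: ext_maximal.
exact: ext_CL1.
Qed.

End Extension.

(** * The three logics as protoalgebraic extensions *)

Lemma extension_TRIV : extension BD_infty TRIV.
Proof. by []. Qed.

Lemma upset_true : upset [set true].
Proof. by move=> [] []. Qed.

Lemma de_morgan_bool : de_morgan negb.
Proof. by split=> [[]|[] []|[] []]. Qed.

Lemma extension_TRIV_minus : extension BD_infty TRIV_minus.
Proof.
split; first split; first split.
- by move=> Gamma phi Gphi; exists phi.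
- by move=> Gamma Delta phi GD [psi /GD]; exists psi.
- by move=> Gamma Delta phi H [psi /H].
- by move=> s hs Gamma phi [psi Gpsi]; exists (s psi), psi.
move=> Gamma phi BD; apply/set0P/negP => /eqP G0.
(* The empty upset satisfies the empty set of premises but no conclusion, so [BD_infty] has no
   theorems. *)
have up0 : @upset _ bool set0 by [].
have := BD _ bool negb de_morgan_bool _ up0 (evalb xpredT).
by apply; rewrite ?G0 ?image_set0.
Qed.

Lemma protoalgebraic_set0 (L : entailment) :
  L [set Var 0] (Var 1) -> protoalgebraic L.
Proof. by move=> H; exists set0; split=> //; rewrite setU0. Qed.

Lemma extension_CL1 : extension BD_infty CL1.
Proof.
split; first split; first split.
- by move=> Gamma phi Gphi v hv; apply; exists phi.
- by move=> Gamma Delta phi GD H v hv D; apply: H => // _ [psi /GD Dpsi <-];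
    apply: D; exists psi.
- move=> Gamma Delta phi H1 H2 v hv G; apply: H2 => // _ [psi Dpsi <-].
  exact: H1.
- move=> s [sA sO sN] Gamma phi H v [vA vO vN] G.
  apply: (H (v \o s)) => [|_ [psi Gpsi <-]].
    by split=> *; rewrite /= (sA, sO, sN) (vA, vO, vN).
  by apply: G; exists (s psi) => //; exists psi.
by move=> Gamma phi H; exact: H de_morgan_bool _ upset_true.
Qed.

Lemma protoalgebraic_CL1 : protoalgebraic CL1.
Proof.
exists [set iff_form (Var 0) (Var 1)]; split=> [_ -> p|_ ->|].
- by rewrite /= !inE => /or4P[] /eqP ->.
- by apply/CL1P => u _ /=; case: (u 0).
apply/CL1P => u H.
have /= := H (iff_form (Var 0) (Var 1)) (or_intror erefl).
by have /= -> := H (Var 0) (or_introl erefl); rewrite /= orbF.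
Qed.

(** This rule holds in [TRIV] and [TRIV_minus], so it separates [CL1] from both. *)
Lemma CL1_not_Var01 : ~ CL1 [set Var 0] (Var 1).
Proof.
move=> /CL1P /(_ (fun n => n == 0)) H.
by suff: evalb (fun n => n == 0) (Var 1) by []; apply: H => _ ->.
Qed.

Theorem mainTheorem16 :
  [/\ protoalgebraic_extension BD_infty TRIV,
      protoalgebraic_extension BD_infty TRIV_minus
    & forall L : entailment,
        [/\ protoalgebraic_extension BD_infty L, L <> TRIV & L <> TRIV_minus]
        <-> L = CL1].
Proof.
split.
- by split; [exact: extension_TRIV | exact: protoalgebraic_set0].
- split; first exact: extension_TRIV_minus.
  by apply: protoalgebraic_set0; exists (Var 0).
move=> L; split=> [[[extL protoL] nT nTm]|->].
  exact: protoalgebraic_ext_CL1.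
split=> [|E|E]; first by split; [exact: extension_CL1|exact: protoalgebraic_CL1].
- by apply: CL1_not_Var01; rewrite E.
- by apply: CL1_not_Var01; rewrite E; exists (Var 0).
Qed.
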